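(* Let $0<\theta<1$ and $X_\theta=(\mathcal E_p,\mathcal D(C))_{\theta,1}$. Assume operational smallness: there exist $h_0>0$ and $q\in(0,1)$ such that $\sup_{t\in[0,T]}\sup_{0<h\le h_0}\|H_h(t)\|_{\mathcal L(\mathcal E_p)}\le q$. Let $t\in[0,T]$ and assume that $R_h(t)$ exists for $0<h\le h_0$ with $\sup_{0<h\le h_0}\|R_h(t)\|_{\mathcal L(\mathcal E_p)}\le M_R$, and that $D(\cdot)$ is uniformly graph-bounded on $\mathcal D(C)$: there are constants $a,b\ge0$ independent of $t$ with $$\|D(t)z\|_{\mathcal E_p}\le a\|z\|_{\mathcal E_p}+b\|Cz\|_{\mathcal E_p},\qquad z\in\mathcal D(C).$$ Then there exists $K_\theta>0$ such that for $0<h\le h_0$, $$\|R_h(t)-P_h(t)\|_{\mathcal L(X_\theta,\mathcal E_p)}\le K_\theta h^\theta .$$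
   Context: Let $X$ be a Banach space, $\tau<0$, $T>0$, $1<p<\infty$, and $\mathcal E_p:=X\oplus L^p([\tau,0];X)$ with norm $\|(u,\rho)\|_{\mathcal E_p}=\|u\|_X+\|\rho\|_{L^p}$. The transport operator is $C(u,\rho):=(0,\partial_\sigma\rho)$ with domain $\mathcal D(C):=\{(u,\rho)\in X\oplus W^{1,p}([\tau,0];X):\rho(0)=u\}$, endowed with the graph norm $\|x\|_{\mathcal E_p}+\|Cx\|_{\mathcal E_p}$; its resolvent $S_h^C:=(I-hC)^{-1}\in\mathcal L(\mathcal E_p)$ exists for every $h>0$. $(\cdot,\cdot)_{\theta,1}$ denotes real interpolation. For $t\in[0,T]$ let $D(t):\mathcal D(C)\to\mathcal E_p$ be linear, and set $H_h(t):=hD(t)S_h^C$, $R_h(t):=(I-h(C+D(t)))^{-1}$ (with $\mathcal D(C+D(t))=\mathcal D(C)$; existence means as a bounded operator on $\mathcal E_p$), and $P_h(t):=(I-H_h(t))^{-1}S_h^C$. *)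

(* Defs.v *)
From HB Require Import structures.
From mathcomp Require Import all_boot all_order all_algebra.
From mathcomp Require Import generic_quotient ring_quotient.
From mathcomp Require Import all_classical all_reals all_analysis.
From mathcomp Require Import measurable_realfun.

Set Implicit Arguments.
Unset Strict Implicit.
Unset Printing Implicit Defensive.

Import Order.TTheory GRing.Theory Num.Theory.
Import numFieldNormedType.Exports.

Local Open Scope classical_set_scope.
Local Open Scope ring_scope.

Section strong_measurability.
Context {R : realType} {X : normedModType R}.
Variable tau : R.
Local Notation I := (`[tau, 0]%classic : set R).

Definition simple_fun (s : R -> X) : Prop :=
  finite_set (range s) /\ forall x, measurable (s @^-1` [set x]).

(* The limit is taken at every point of [tau, 0] rather than almost everywhere.
   The classes modulo almost everywhere equality are the same, because an
   almost everywhere limit of simple functions agrees almost everywhere with an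
   everywhere limit of simple functions. *)
Definition strongly_measurable (f : R -> X) : Prop :=
  exists s : nat -> R -> X, (forall n, simple_fun (s n)) /\
    forall x, I x -> s n x @[n --> \oo] --> f x.

Lemma simple_fun_cst (c : X) : simple_fun (cst c).
Proof.
split=> [|x].
  by apply: (@sub_finite_set _ _ [set c]) => // _ [y _ <-].
by rewrite preimage_cst; case: ifP => _; [exact: measurableT|exact: measurable0].
Qed.

Lemma simple_fun_op (op : X -> X -> X) (s1 s2 : R -> X) :
  simple_fun s1 -> simple_fun s2 -> simple_fun (fun x => op (s1 x) (s2 x)).
Proof.
move=> [f1 m1] [f2 m2]; split.
  apply: (@sub_finite_set _ _
    ((fun u => op u.1 u.2) @` (range s1 `*` range s2))).
    by move=> _ [x _ <-]; exists (s1 x, s2 x) => //; split; exists x.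
  exact/finite_image/finite_setX.
move=> z.
rewrite [X in measurable X](_ : _ =
  \bigcup_(u in (range s1 `*` range s2) `&` [set u | op u.1 u.2 = z])
     (s1 @^-1` [set u.1] `&` s2 @^-1` [set u.2])).
  apply: fin_bigcup_measurable.
    by apply: finite_setIl; exact: finite_setX.
  by move=> u _; exact: measurableI.
apply/seteqP; split=> [x /= opx|x [[u1 u2] /= [_ <-] [-> ->]]//].
by exists (s1 x, s2 x) => //=; split => //; split; exists x.
Qed.

Lemma simple_fun_norm (s : R -> X) : simple_fun s ->
  measurable_fun [set: R] (fun x => `|s x|).
Proof.
move=> [fs ms] _ B _; rewrite setTI.
rewrite [X in measurable X](_ : _ =
  \bigcup_(u in range s `&` [set u | B `|u|]) (s @^-1` [set u])).
  by apply: fin_bigcup_measurable => //; exact: finite_setIl.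
apply/seteqP; split=> [x /= Bx|x [u /= [_ Bu] ->]//].
by exists (s x) => //; split => //; exists x.
Qed.

Lemma strongly_measurable0 : strongly_measurable 0.
Proof.
by exists (fun=> cst 0); split=> [n|x _]; [exact: simple_fun_cst|exact: cvg_cst].
Qed.

Lemma strongly_measurableD f g : strongly_measurable f ->
  strongly_measurable g -> strongly_measurable (f + g).
Proof.
move=> [s [ss sf]] [r [sr rg]].
exists (fun n x => s n x + r n x); split=> [n|x Ix]; first exact: simple_fun_op.
by apply: cvgD; [exact: sf|exact: rg].
Qed.

Lemma strongly_measurableZ (a : R) f : strongly_measurable f ->
  strongly_measurable (a *: f).
Proof.
move=> [s [ss sf]]; exists (fun n x => a *: s n x); split=> [n|x Ix].
  exact: (simple_fun_op (fun u _ => a *: u) (ss n) (ss n)).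
by apply: cvgZr; exact: sf.
Qed.

Lemma strongly_measurable_norm f : strongly_measurable f ->
  measurable_fun I (fun x => `|f x|).
Proof.
move=> [s [ss sf]].
apply: (@measurable_fun_cvg _ _ _ _ (fun n x => `|s n x|)) => [n|x Ix].
  exact: measurable_funS (simple_fun_norm (ss n)).
by apply: cvg_norm; exact: sf.
Qed.

End strong_measurability.

Section Lp_functions.
Context {R : realType} (X : normedModType R) (tau : R) (p : R).
Local Notation I := (`[tau, 0]%classic : set R).
Local Notation mu := (@lebesgue_measure R).

Definition Lp_Lnorm (f : R -> X) : \bar R :=
  'N[mu]_p%:E[(EFin \o Num.norm \o f) \_ I]%E.

Definition Lp_fun : {pred (R -> X)} := mem [set f : R -> X |
  strongly_measurable tau f /\ (Lp_Lnorm f < +oo)%E].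

Hypothesis p1 : 1 < p.

Let mI : measurable I. Proof. exact: measurable_itv. Qed.

Let p_gt0 : 0 < p. Proof. exact: lt_trans p1. Qed.

Let nr (f : R -> X) (x : R) : R := if x \in I then `|f x| else 0.

Let Lp_LnormE f : Lp_Lnorm f = 'N[mu]_p%:E[EFin \o nr f]%E.
Proof.
by apply: eq_Lnorm => x; rewrite patchE /= /nr; case: ifP.
Qed.

Let measurable_nr (f : R -> X) : strongly_measurable tau f ->
  measurable_fun [set: R] (nr f).
Proof.
move=> mf; apply/measurable_EFinP.
rewrite [X in measurable_fun _ X](_ : _ = (EFin \o (fun x => `|f x|)) \_ I); last first.
  by apply/funext => x; rewrite patchE /= /nr; case: ifP.
have := measurable_restrictT (EFin \o (fun x => `|f x|)) mI.
move=> [H _]; apply: H. apply: measurableT_comp => //.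
exact: strongly_measurable_norm.
Qed.

Lemma Lp_Lnorm_ge0 f : (0 <= Lp_Lnorm f)%E. Proof. exact: Lnorm_ge0. Qed.

Lemma Lp_LnormD (f g : R -> X) :
  strongly_measurable tau f -> strongly_measurable tau g ->
  (Lp_Lnorm (f + g)%R <= Lp_Lnorm f + Lp_Lnorm g)%E.
Proof.
move=> mf mg.
have := minkowski_EFin mu (measurable_nr mf) (measurable_nr mg) (ltW p1).
rewrite !Lp_LnormE; apply: le_trans.
rewrite unlock; apply: gt0_ler_poweR; rewrite ?invr_ge0 ?(ltW p_gt0)//.
- by rewrite in_itv/= leey andbT integral_ge0// => x _; exact: poweR_ge0.
- by rewrite in_itv/= leey andbT integral_ge0// => x _; exact: poweR_ge0.
have mpow (h : R -> R) : measurable_fun [set: R] h ->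
    measurable_fun [set: R] (fun x => (`|(h x)%:E| `^ p)%E).
  move=> mh; apply: (@measurableT_comp _ _ _ _ _ _ (fun x => (x `^ p)%E)).
    exact: measurable_poweR.
  by apply: measurableT_comp => //; exact/measurable_EFinP.
apply: ge0_le_integral => //.
- by move=> x _; exact: poweR_ge0.
- by apply: mpow; apply: measurable_nr; exact: strongly_measurableD.
- by apply: mpow; apply: measurable_funD; exact: measurable_nr.
move=> x _; rewrite !abse_EFin !poweR_EFin lee_fin ge0_ler_powR ?nnegrE ?(ltW p_gt0)//.
rewrite /nr /=; case: ifP => _; last by rewrite addr0.
by rewrite normr_id ger0_norm ?addr_ge0//; exact: ler_normD.
Qed.

Lemma Lp_LnormZ a (f : R -> X) : strongly_measurable tau f ->
  Lp_Lnorm (a *: f) = (`|a|%:E * Lp_Lnorm f)%E.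
Proof.
move=> mf; rewrite !Lp_LnormE unlock.
have -> : (\int[mu]_x `|(EFin \o nr (a *: f)) x| `^ p =
    (`|a| `^ p)%:E * \int[mu]_x `|(EFin \o nr f) x| `^ p)%E.
  rewrite -ge0_integralZl ?lee_fin ?powR_ge0//.
  - apply: eq_integral => x _; rewrite /= -EFinM; congr EFin.
    rewrite -powRM//; congr (_ `^ _); rewrite -{1}(normr_id a) -normrM; congr Num.norm.
    by rewrite /nr; case: ifP => _; rewrite ?mulr0// -normrZ.
  - apply: (@measurableT_comp _ _ _ _ _ _ (fun x => (x `^ p)%E)).
      exact: measurable_poweR.
    by apply: measurableT_comp => //; apply/measurable_EFinP; exact: measurable_nr.
  - by move=> x _; exact: poweR_ge0.
rewrite poweRM ?lee_fin ?powR_ge0 ?integral_ge0//.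
  by rewrite poweR_EFin -powRrM divff ?gt_eqF// powRr1.
by move=> x _; exact: poweR_ge0.
Qed.

Lemma Lp_Lnorm0 : Lp_Lnorm 0 = 0%E.
Proof.
rewrite -[RHS](@Lnorm0 _ _ _ mu p%:E) ?eqe ?gt_eqF//.
by apply: eq_Lnorm => x; rewrite patchE /=; case: ifP => //; rewrite normr0.
Qed.

Definition ae_null (f : R -> X) : Prop := {ae mu, forall x, I x -> f x = 0}.

Lemma Lp_Lnorm_eq0 (f : R -> X) : strongly_measurable tau f ->
  Lp_Lnorm f = 0%E <-> ae_null f.
Proof.
move=> mf; split.
  rewrite Lp_LnormE => /Lnorm_eq0_eq0; rewrite lte_fin => /(_ _ p_gt0) f0.
  have /f0 : measurable_fun [set: R] (EFin \o nr f).
    by apply/measurable_EFinP; exact: measurable_nr.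
  apply: filterS => x /= /(_ Logic.I) [] /eqP + Ix.
  by rewrite /nr mem_set// normr_eq0 => /eqP.
move=> f0.
rewrite Lp_LnormE unlock (@ae_eq_integral _ _ _ mu setT (cst 0%E))//.
- by rewrite integral0 poweR0r// invr_eq0 gt_eqF.
- apply: (@measurableT_comp _ _ _ _ _ _ (fun x => (x `^ p)%E)).
    exact: measurable_poweR.
  by apply: measurableT_comp => //; apply/measurable_EFinP; exact: measurable_nr.
move: f0; apply: (@filterS _ _ (ae_filter_ringOfSetsType mu)) => x f0 _.
have nr0 : nr f x = 0.
  by rewrite /nr; case: ifPn => // /set_mem/f0 ->; rewrite normr0.
by rewrite [(EFin \o nr f) x]/= nr0 abse0 poweR0r// gt_eqF.
Qed.

Lemma Lp_fun_submod_closed : submod_closed Lp_fun.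
Proof.
split=> [|a f g].
  by rewrite inE /=; split; [exact: strongly_measurable0|rewrite Lp_Lnorm0].
rewrite !inE /= => -[mf fy] [mg gy]; split.
  by apply: strongly_measurableD => //; exact: strongly_measurableZ.
apply: le_lt_trans (Lp_LnormD (strongly_measurableZ _ mf) mg) _.
rewrite Lp_LnormZ// lte_add_pinfty// lte_mul_pinfty ?lee_fin//.
Qed.

End Lp_functions.

Section Lp_pre_space.
Context {R : realType} (X : normedModType R) (tau p : R) (p1 : 1 < p).

(* The proof of 1 < p is an argument so that the closure instances, which
   depend on it, are inferred from the type. *)
Definition Lp_fun_key of 1 < p : {pred (R -> X)} := Lp_fun tau p.

HB.instance Definition _ := GRing.isSubmodClosed.Build R (R -> X)
  (Lp_fun_key p1) (Lp_fun_submod_closed X tau p1).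

Record preLp := PreLp {
  preLp_fun :> R -> X ; preLp_funP : preLp_fun \in Lp_fun_key p1 }.

HB.instance Definition _ := [isSub for preLp_fun].
HB.instance Definition _ := [Choice of preLp by <:].
HB.instance Definition _ := [SubChoice_isSubLmodule of preLp by <:].

Definition null_pred : {pred preLp} := mem [set f : preLp | ae_null tau f].

Lemma null_zmod_closed : zmod_closed null_pred.
Proof.
have aeF := ae_filter_ringOfSetsType (@lebesgue_measure R).
split; first by rewrite inE /=; exact: (@nearW _ _ _ aeF).
move=> f g; rewrite !inE /=; apply: (@filterS2 _ _ aeF) => x f0 g0 Ix.
by rewrite -[LHS]/(f x - g x : X) [f x]f0// [g x]g0//; exact: subrr.
Qed.

HB.instance Definition _ := GRing.isZmodClosed.Build preLp null_pred
  null_zmod_closed.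

(* L^p([tau, 0]; X). Elements of preLp are functions on R whose values outside
   [tau, 0] play no role: they are identified by null_pred. *)
Definition Lp : Type := Quotient.quot null_pred.

HB.instance Definition _ := Choice.on Lp.
HB.instance Definition _ := GRing.Zmodule.on Lp.
HB.instance Definition _ := Quotient.on Lp.

Definition Lp_class (f : preLp) : Lp := (\pi_Lp f)%qT.

Definition Lp_repr (z : Lp) : preLp := repr z.

Lemma Lp_reprK z : Lp_class (Lp_repr z) = z. Proof. exact: reprK. Qed.

Lemma Lp_classP f g : Lp_class f = Lp_class g <->
  {ae @lebesgue_measure R, forall x, `[tau, 0]%classic x -> f x = g x}.
Proof.
have aeF := ae_filter_ringOfSetsType (@lebesgue_measure R).
have fgE : (Lp_class f == Lp_class g) = (f - g \in null_pred).
  by rewrite Quotient.idealrBE.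
split=> [/eqP|fg].
  rewrite fgE inE /=; apply: (@filterS _ _ aeF) => x fg /fg fgx.
  by apply: subr0_eq; exact: fgx.
apply/eqP; rewrite fgE inE /=; move: fg.
apply: (@filterS _ _ aeF) => x fg /fg fgx.
by rewrite -[LHS]/(f x - g x : X) fgx; exact: subrr.
Qed.

Lemma Lp_classD f g : Lp_class (f + g) = Lp_class f + Lp_class g.
Proof. exact: Quotient.pi_add. Qed.

Definition Lp_scale (a : R) (z : Lp) : Lp := Lp_class (a *: Lp_repr z).

Lemma Lp_classZ a f : Lp_class (a *: f) = Lp_scale a (Lp_class f).
Proof.
have aeF := ae_filter_ringOfSetsType (@lebesgue_measure R).
apply/Lp_classP; have /Lp_classP := Lp_reprK (Lp_class f).
apply: (@filterS _ _ aeF) => x fx /fx fxE.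
exact: (congr1 ( *:%R a) (esym fxE)).
Qed.

Lemma Lp_scaleA a b z : Lp_scale a (Lp_scale b z) = Lp_scale (a * b) z.
Proof. by rewrite -[z]Lp_reprK -!Lp_classZ scalerA. Qed.

Lemma Lp_scale1 : left_id 1 Lp_scale.
Proof. by move=> z; rewrite -[z]Lp_reprK -!Lp_classZ scale1r. Qed.

Lemma Lp_scaleDr : right_distributive Lp_scale +%R.
Proof.
move=> a z w; rewrite -[z]Lp_reprK -[w]Lp_reprK.
by rewrite -Lp_classD -!Lp_classZ scalerDr Lp_classD.
Qed.

Lemma Lp_scaleDl z : {morph Lp_scale^~ z : a b / a + b}.
Proof.
by move=> a b; rewrite -[z]Lp_reprK -!Lp_classZ scalerDl Lp_classD.
Qed.

HB.instance Definition _ := GRing.Zmodule_isLmodule.Build R Lp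
  Lp_scaleA Lp_scale1 Lp_scaleDr Lp_scaleDl.

Definition Lp_norm (z : Lp) : R := fine (Lp_Lnorm tau p (Lp_repr z)).

Let preLp_meas (f : preLp) : strongly_measurable tau f.
Proof. by have := preLp_funP f; rewrite inE => -[]. Qed.

Let preLp_fin (f : preLp) : Lp_Lnorm tau p f \is a fin_num.
Proof.
have := preLp_funP f; rewrite inE => -[_ fy].
by rewrite ge0_fin_numE//; exact: Lp_Lnorm_ge0.
Qed.

Lemma Lp_norm_class f : Lp_norm (Lp_class f) = fine (Lp_Lnorm tau p f).
Proof.
have aeF := ae_filter_ringOfSetsType (@lebesgue_measure R).
have null (g h : preLp) : Lp_class g = Lp_class h ->
    (Lp_Lnorm tau p g <= Lp_Lnorm tau p h)%E.
  move/Lp_classP => gh.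
  have -> : preLp_fun g = (g - h) + h by rewrite subrK.
  apply: le_trans (Lp_LnormD p1 (preLp_meas _) (preLp_meas _)) _.
  rewrite (Lp_Lnorm_eq0 p1 (preLp_meas (g - h))).2 ?add0e//.
  move: gh; apply: (@filterS _ _ aeF) => x gh /gh ghx.
  by rewrite -[LHS]/(g x - h x : X) ghx; exact: subrr.
congr fine; apply/eqP; rewrite eq_le !null// ?Lp_reprK//.
Qed.

Lemma Lp_ler_normD z w : Lp_norm (z + w) <= Lp_norm z + Lp_norm w.
Proof.
rewrite -[z]Lp_reprK -[w]Lp_reprK -Lp_classD !Lp_norm_class.
rewrite -lee_fin EFinD !fineK//.
exact: (Lp_LnormD p1 (preLp_meas _) (preLp_meas _)).
Qed.

Lemma Lp_normZ a z : Lp_norm (a *: z) = `|a| * Lp_norm z.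
Proof.
rewrite -[z]Lp_reprK -[a *: _]Lp_classZ !Lp_norm_class.
by rewrite (Lp_LnormZ p1 a (preLp_meas _)) fineM.
Qed.

Lemma Lp_class0 : Lp_class 0 = 0.
Proof. by apply: (@addrI _ (Lp_class 0)); rewrite -Lp_classD !addr0. Qed.

Lemma Lp_norm0_eq0 z : Lp_norm z = 0 -> z = 0.
Proof.
move=> z0; rewrite -[z]Lp_reprK -Lp_class0; apply/Lp_classP.
apply/(Lp_Lnorm_eq0 p1 (preLp_meas _)).
by rewrite -[LHS]fineK// -/(Lp_norm z) z0.
Qed.

HB.instance Definition _ := Lmodule_isNormed.Build R Lp
  Lp_ler_normD Lp_normZ Lp_norm0_eq0.

End Lp_pre_space.

Section Ep.
Context {R : realType} (X : normedModType R) (tau p : R) (p1 : 1 < p).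

(* Ep is a copy of the product type, which the library equips with the maximum
   norm; the norm of Ep is the sum of the two norms. *)
Definition Ep : Type := (X * Lp X tau p1)%type.

HB.instance Definition _ := GRing.Lmodule.on Ep.

Definition Ep_norm (z : Ep) : R := `|z.1| + `|z.2|.

Lemma Ep_ler_normD (z w : Ep) : Ep_norm (z + w) <= Ep_norm z + Ep_norm w.
Proof. by rewrite /Ep_norm addrACA lerD// ler_normD. Qed.

Lemma Ep_normZ a (z : Ep) : Ep_norm (a *: z) = `|a| * Ep_norm z.
Proof. by rewrite /Ep_norm !normrZ mulrDr. Qed.

Lemma Ep_norm0_eq0 (z : Ep) : Ep_norm z = 0 -> z = 0.
Proof.
case: z => u r /eqP; rewrite /Ep_norm /= paddr_eq0// !normr_eq0.
by move=> /andP[/eqP-> /eqP->].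
Qed.

HB.instance Definition _ := Lmodule_isNormed.Build R Ep
  Ep_ler_normD Ep_normZ Ep_norm0_eq0.

Lemma Ep_normE (z : Ep) : `|z| = `|z.1| + `|z.2|. Proof. by []. Qed.

End Ep.

Section bochner_integral.
Context {R : realType} {X : normedModType R}.
Variable tau : R.
Local Notation I := (`[tau, 0]%classic : set R).
Local Notation mu := (@lebesgue_measure R).

Definition simple_integral (s : R -> X) : X :=
  \sum_(x \in range s) fine (mu (I `&` s @^-1` [set x])) *: x.

Definition is_bochner_integral (f : R -> X) (v : X) : Prop :=
  strongly_measurable tau f /\
  exists s : nat -> R -> X, [/\ forall n, simple_fun (s n),
    (\int[mu]_(x in I) `|f x - s n x|%:E)%E @[n --> \oo] --> 0%E &
    simple_integral (s n) @[n --> \oo] --> v].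

Definition bochner_integral (f : R -> X) : X :=
  xget 0 [set v | is_bochner_integral f v].

End bochner_integral.

(* Test functions in C_c^oo(]tau, 0[). *)
Definition test_function {R : realType} (tau : R) (phi : R -> R) : Prop :=
  (forall n x, derivable (phi^`(n))%classic x 1) /\
  exists a b, [/\ tau < a, b < 0 & forall x, x \notin `[a, b] -> phi x = 0].

Section transport.
Context {R : realType} (X : normedModType R) (tau p : R) (p1 : 1 < p).
Local Notation I := (`[tau, 0]%classic : set R).
Local Notation Lp := (Lp X tau p1).
Local Notation Ep := (Ep X tau p1).

Definition is_weak_derivative (r g : Lp) : Prop :=
  forall phi, test_function tau phi ->
    bochner_integral tau (fun x => (phi^`())%classic x *: Lp_repr r x) =
    - bochner_integral tau (fun x => phi x *: Lp_repr g x).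

Definition W1p : set Lp := [set r | exists g, is_weak_derivative r g].

Definition weak_derivative (r : Lp) : Lp := xget 0 [set g | is_weak_derivative r g].

(* r(0) = u, where r(0) is the value at 0 of the continuous representative. *)
Definition trace0 (r : Lp) (u : X) : Prop :=
  exists c : R -> X, [/\ {within I, continuous c},
    {ae @lebesgue_measure R, forall x, I x -> Lp_repr r x = c x} & c 0 = u].

Definition transport_dom : set Ep := [set z | W1p z.2 /\ trace0 z.2 z.1].

Definition transport (z : Ep) : Ep := (0, weak_derivative z.2).

End transport.
Arguments transport_dom {R} X tau {p} p1 _.
Arguments transport {R} X tau {p} p1 _.

(* An operator with domain dom is given by a total function whose values
   outside dom are irrelevant. *)
Section operators.
Context {R : realType} {V : normedModType R}.
Implicit Types (dom : set V) (A B : V -> V).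

Definition linear_on dom A : Prop := forall a x y, dom x -> dom y ->
  A (a *: x + y) = a *: A x + A y.

Definition is_bounded_inverse dom A B : Prop :=
  [/\ linear B, continuous B, forall x, dom (B x) /\ A (B x) = x &
    forall z, dom z -> B (A z) = z].

Definition bounded_inverse dom A : V -> V :=
  xget (cst 0) [set B | is_bounded_inverse dom A B].

Definition has_resolvent dom A (h : R) : Prop :=
  exists B, is_bounded_inverse dom (fun z => z - h *: A z) B.

Definition resolvent dom A (h : R) : V -> V :=
  bounded_inverse dom (fun z => z - h *: A z).

(* Operator norm from the space normed by N (N x = +oo off that space) to V. *)
Definition op_norm (N : V -> \bar R) A : \bar R :=
  ereal_sup [set `|A x|%:E | x in [set x | (N x <= 1)%E]].

Definition graph_norm A (x : V) : R := `|x| + `|A x|.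

Definition K_functional dom (N : V -> R) (s : R) (x : V) : R :=
  inf [set c | exists a b, [/\ dom b, x = a + b & c = `|a| + s * N b]].

(* Norm of (V, dom)_{theta, 1} by the K-method, dom being normed by N; the
   space is the set where it is finite. *)
Definition interp_norm dom (N : V -> R) (theta : R) (x : V) : \bar R :=
  (\int[@lebesgue_measure R]_(s in `]0%R, +oo[)
     (s `^ (- theta) * K_functional dom N s x / s)%:E)%E.

End operators.

Section perturbation.
Context {R : realType} {V : normedModType R}.
Variables (dom : set V) (C : V -> V) (D : R -> V -> V).

Definition H_op (h t : R) (x : V) : V := h *: D t (resolvent dom C h x).

Definition R_op (h t : R) : V -> V := resolvent dom (fun z => C z + D t z) h.

Definition P_op (h t : R) (x : V) : V :=
  bounded_inverse setT (fun z => z - H_op h t z) (resolvent dom C h x).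

End perturbation.

(* Main.v *)
(* Since I - h(C + D) = (I - H_h)(I - hC), the operator I - H_h is invertible
   with inverse (I - hC) R_h, of norm at most 1 / (1 - q), and
   S_h = R_h (I - H_h) is bounded uniformly in h. Hence R_h - P_h is bounded
   uniformly in h, and it is O(h) for the graph norm on D(C), because both
   R_h z - z and P_h z - z are. Splitting x = a + b with b in D(C) bounds
   |(R_h - P_h) x| by a multiple of K(h, x). As K(., x) is nondecreasing, the
   part over [h, 2h] of the integral defining the norm of X_theta is at least a
   multiple of h^(- theta) K(h, x), whence the rate h^theta. *)
From HB Require Import structures.
Require Import Defs.
From mathcomp Require Import all_boot all_order all_algebra.
From mathcomp Require Import all_classical all_reals all_analysis.
From mathcomp Require Import measurable_realfun ring lra.
Import Order.TTheory GRing.Theory Num.Theory.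
Import numFieldNormedType.Exports.
Local Open Scope classical_set_scope.
Local Open Scope ring_scope.

(** * Operator norms and the chosen resolvent *)

Section linear_operators.
Context {R : realType} {V : normedModType R}.
Implicit Types (A B C : V -> V) (dom : set V).

Lemma op_norm_le (N : V -> \bar R) A (k : R) :
  (forall x, (N x <= 1)%E -> `|A x| <= k) -> (op_norm N A <= k%:E)%E.
Proof.
move=> Ak; apply: ge_ereal_sup => _ [x /= Nx <-].
by rewrite lee_fin Ak.
Qed.

Lemma linear_additive {A} : linear A -> forall x y, A (x + y) = A x + A y.
Proof. by move=> lA x y; have := lA 1 x y; rewrite !scale1r. Qed.

Lemma linear_op_norm_le {A} {k : R} : linear A ->
  (op_norm (fun x => `|x|%:E) A <= k%:E)%E -> forall x, `|A x| <= k * `|x|.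
Proof.
move=> lA Ak x.
have AZ (c : R) y : A (c *: y) = c *: A y.
  have A0 : A 0 = 0.
    by apply: (@addrI _ (A 0)); rewrite addr0 -linear_additive// addr0.
  by rewrite -[c *: y]addr0 lA A0 addr0.
have [->|x0] := eqVneq x 0.
  by rewrite -(scale0r 0) AZ !scale0r normr0 mulr0.
have nx : 0 < `|x| by rewrite normr_gt0.
(* The supremum in [op_norm] sees only the unit ball, so [x] is rescaled to norm 1. *)
have : (`|A (`|x|^-1 *: x)|%:E <= k%:E)%E.
  apply: le_trans Ak; apply: ereal_sup_ubound; exists (`|x|^-1 *: x) => //=.
  by rewrite lee_fin normrZ gtr0_norm ?invr_gt0// mulVf ?gt_eqF.
rewrite lee_fin AZ normrZ gtr0_norm ?invr_gt0//.
by rewrite mulrC ler_pdivrMr.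
Qed.

Lemma op_norm_norm_ge0 {A} {k : R} :
  (op_norm (fun x => `|x|%:E) A <= k%:E)%E -> 0 <= k.
Proof.
move=> Ak; have : (`|A 0|%:E <= k%:E)%E.
  apply: le_trans Ak; apply: ereal_sup_ubound; exists 0 => //=.
  by rewrite lee_fin normr0.
by rewrite lee_fin; apply: le_trans.
Qed.

Lemma linear_lipschitz_continuous A (k : R) : linear A ->
  (forall x, `|A x| <= k * `|x|) -> continuous A.
Proof.
move=> lA Ak.
pose hA := GRing.isLinear.Build R V V *:%R A lA.
pose fA : {linear V -> V} := HB.pack A hA.
apply: (linear_bounded_continuous fA).1.
apply/linear_boundedP; near=> r => x.
apply: le_trans (Ak x) _; exact: ler_wpM2r.
Unshelve. all: by end_near. Qed.

Lemma resolventP {dom A} {h : R} : has_resolvent dom A h ->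
  is_bounded_inverse dom (fun z => z - h *: A z) (resolvent dom A h).
Proof. exact: xgetPex. Qed.

End linear_operators.

(** * The K-functional and a pointwise lower bound for the interpolation norm *)

Section interpolation.
Context {R : realType} {V : normedModType R}.
Variables (dom : set V) (N : V -> R).
Hypothesis N_ge0 : forall x, 0 <= N x.
Hypothesis dom0 : dom 0.

Lemma K_functional_ge0 (s : R) x : 0 <= s -> 0 <= K_functional dom N s x.
Proof.
move=> s0; apply: lb_le_inf.
  by exists (`|x| + s * N 0), x, 0; split => //; rewrite addr0.
by move=> _ [a [b [_ _ ->]]]; rewrite addr_ge0// mulr_ge0.
Qed.

(** Every splitting of [x] costs no more at [s] than at [r], because [N] is nonnegative. *)
Lemma le_K_functional (s r : R) x : 0 <= s <= r ->
  K_functional dom N s x <= K_functional dom N r x.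
Proof.
move=> /andP[s0 sr]; apply: lb_le_inf.
  by exists (`|x| + r * N 0), x, 0; split => //; rewrite addr0.
move=> _ [a [b [db xab ->]]].
apply: (@le_trans _ _ (`|a| + s * N b)); last by rewrite lerD2l ler_wpM2r.
apply: ge_inf; last by exists a, b.
by exists 0 => _ [c [d [_ _ ->]]]; rewrite addr_ge0// mulr_ge0.
Qed.

Lemma interp_norm_ge (theta s : R) x : 0 < theta -> 0 < s ->
  (((2 * s) `^ (- theta) / 2 * K_functional dom N s x)%:E
     <= interp_norm dom N theta x)%E.
Proof.
move=> t0 s0.
pose K r := K_functional dom N r x.
have mK : measurable_fun (`]0, +oo[%classic : set R) K.
  (* [K] is known to be monotone only on nonnegative arguments; truncating at 0 gives a function
     monotone on the whole line, hence measurable. *)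
  apply: (eq_measurable_fun (K \o Num.max 0)).
    move=> r; rewrite inE /= in_itv /= andbT => r0.
    by rewrite /= max_r// ltW.
  apply: nondecreasing_measurable => // r1 r2 r12 /=.
  apply: le_K_functional; rewrite le_max lexx/=.
  by rewrite ge_max !le_max lexx r12 orbT.
have mF : measurable_fun (`]0, +oo[%classic : set R)
    (fun r : R => (r `^ (- theta) * K r / r)%:E).
  apply/measurable_EFinP; apply: measurable_funM; last first.
    apply: (eq_measurable_fun (fun r : R => r `^ (-1))).
      by move=> r; rewrite inE /= in_itv /= andbT => /ltW r0; rewrite powR_inv1.
    by apply: measurable_funTS; exact: measurable_powR.
  apply: measurable_funM => //.
  by apply: measurable_funTS; exact: measurable_powR.
pose J : set R := `[s, 2 * s]%classic.
have sI : J `<=` `]0, +oo[%classic.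
  move=> r /=; rewrite !in_itv/= andbT => /andP[sr _].
  exact: lt_le_trans s0 sr.
have s2 : s < 2 * s by lra.
have c0 : 0 <= (2 * s) `^ (- theta) / (2 * s) * K s.
  by rewrite mulr_ge0 ?divr_ge0 ?powR_ge0 ?K_functional_ge0//; lra.
rewrite /interp_norm.
apply: (@le_trans _ _ (\int[@lebesgue_measure R]_(r in J)
    (r `^ (- theta) * K r / r)%:E)%E); last first.
  apply: ge0_subset_integral => //.
    exact: measurable_itv.
  move=> r /=; rewrite in_itv/= andbT => r0.
  by rewrite lee_fin divr_ge0 ?mulr_ge0 ?powR_ge0 ?K_functional_ge0// ltW.
(* On [J] the decreasing factors are smallest at [2 * s] and [K] at [s]. The length [s] of [J]
   against [1 / (2 * s)] leaves the factor 1/2. *)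
apply: (@le_trans _ _ (\int[@lebesgue_measure R]_(r in J)
    cst ((2 * s) `^ (- theta) / (2 * s) * K s)%:E r)%E).
  rewrite integral_cst; last exact: measurable_itv.
  rewrite [X in (_ * X)%E]/=.
  have -> : lebesgue_measure J = s%:E :> \bar R.
    rewrite lebesgue_measure_itv/= lte_fin s2 -EFinB; congr EFin; ring.
  rewrite -EFinM lee_fin le_eqVlt; apply/orP; left; apply/eqP.
  rewrite /K; field; lra.
apply: ge0_le_integral => //.
- exact: measurable_itv.
- by apply: measurable_funS mF => //; exact: measurable_itv.
- move=> r; rewrite /J /= in_itv/= => /andP[sr rs]; rewrite lee_fin.
  have r0 : 0 < r by exact: lt_le_trans s0 sr.
  have Ksr : K s <= K r by apply: le_K_functional; rewrite sr ltW.
  have Ks0 : 0 <= K s by apply: K_functional_ge0; exact: ltW.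
  have i0 : 0 <= (2 * s)^-1 by rewrite invr_ge0; lra.
  have pr : (2 * s) `^ (- theta) <= r `^ (- theta).
    rewrite !powRN lef_pV2 ?posrE ?powR_gt0//; last by lra.
    by rewrite ge0_ler_powR ?nnegrE//; lra.
  have ir : (2 * s)^-1 <= r^-1 by rewrite lef_pV2 ?posrE//; lra.
  rewrite /= [leLHS]mulrAC -/(K r).
  have pK0 : 0 <= (2 * s) `^ (- theta) * K s by rewrite mulr_ge0 ?powR_ge0.
  by apply: ler_pM => //; apply: ler_pM => //; exact: powR_ge0.
Qed.

End interpolation.

(** * Resolvents of [C] and [C + D t] at a fixed step [h] *)

Section resolvent_comparison.
Context {R : realType} {V : normedModType R}.
Variables (dom : set V) (C : V -> V).

Lemma resolvent_dom (h : R) : has_resolvent dom C h ->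
  forall z, dom z -> exists x, z = resolvent dom C h x.
Proof. by move=> /resolventP[_ _ _ SK] z /SK; exists (z - h *: C z). Qed.

Lemma resolvent_dom_linear (h : R) : has_resolvent dom C h ->
  forall a x y, dom x -> dom y -> dom (a *: x + y).
Proof.
move=> rC a x y /(resolvent_dom _ rC)[u ->] /(resolvent_dom _ rC)[v ->].
by have [lS _ Sdom _] := resolventP rC; rewrite -lS; have [] := Sdom (a *: u + v).
Qed.

Lemma scale_generator_resolvent (h : R) : has_resolvent dom C h ->
  forall x, h *: C (resolvent dom C h x) = resolvent dom C h x - x.
Proof.
move=> rC x; have [_ _ Sdom _] := resolventP rC.
by have [_ {3}<-] := Sdom x; rewrite opprB addrC subrK.
Qed.

(** The domain is the range of the linear map [S], and there [h C S x = S x - x] is linear in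
    [x]. *)
Lemma has_resolvent_linear_on (h : R) : 0 < h -> has_resolvent dom C h ->
  linear_on dom C.
Proof.
move=> h0 rC a x y /(resolvent_dom _ rC)[u ->] /(resolvent_dom _ rC)[v ->].
have [lS _ _ _] := resolventP rC.
apply: (@scalerI _ _ h); first by rewrite gt_eqF.
rewrite scalerDr scalerA (mulrC h) -scalerA -lS !scale_generator_resolvent//.
by rewrite lS scalerBr opprD addrACA.
Qed.

(** Multiplied by [h], both sides equal [S z - z]: on the left by [S (z - h C z) = z], on the right
    by [(I - h C) S z = z]. *)
Lemma resolvent_generatorC (h : R) : 0 < h -> has_resolvent dom C h ->
  forall z, dom z -> resolvent dom C h (C z) = C (resolvent dom C h z).
Proof.
move=> h0 rC z dz; have [lS _ Sdom SK] := resolventP rC.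
apply: (@scalerI _ _ h); first by rewrite gt_eqF.
rewrite scale_generator_resolvent//.
have := SK z dz; rewrite addrC -scaleNr lS scaleNr addrC => /eqP.
by rewrite subr_eq => /eqP ->; rewrite addrAC subrr add0r.
Qed.

Variable D : R -> V -> V.
Variables (h t q : R).
Hypothesis h0 : 0 < h.
Hypothesis rC : has_resolvent dom C h.
Hypothesis rCD : has_resolvent dom (fun z => C z + D t z) h.
Hypothesis lD : linear_on dom (D t).
Hypothesis Hq : (op_norm (fun x => `|x|%:E) (H_op dom C D h t) <= q%:E)%E.
Hypothesis q1 : q < 1.

Local Notation S := (resolvent dom C h).
Local Notation H := (H_op dom C D h t).
Local Notation RR := (R_op dom C D h t).

Lemma H_op_linear : linear H.
Proof.
have [lS _ Sdom _] := resolventP rC => a x y; rewrite /H_op lS lD.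
- by rewrite scalerDr !scalerA (mulrC a).
- by case: (Sdom x).
- by case: (Sdom y).
Qed.

Lemma H_op_le x : `|H x| <= q * `|x|.
Proof. exact: linear_op_norm_le H_op_linear Hq x. Qed.

Lemma one_sub_H_op_inverse :
  is_bounded_inverse setT (fun z => z - H z)
    (bounded_inverse setT (fun z => z - H z)).
Proof.
apply: xgetPex.
have [lS _ Sdom SK] := resolventP rC.
have [lR _ Rdom RK] := resolventP rCD.
(* Since [S] undoes [I - h C] on the domain, [H (B x) = h D (RR x)], so [B x - H (B x)] is
   [(I - h (C + D)) (RR x) = x]. *)
pose B x := RR x - h *: C (RR x).
have lB : linear B.
  move=> a x y; rewrite /B /R_op lR (has_resolvent_linear_on _ h0 rC);
    [|by case: (Rdom x)|by case: (Rdom y)].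
  by rewrite scalerBr scalerDr !scalerA (mulrC h) opprD addrACA.
have BK x : B x - H (B x) = x.
  have [dR RE] := Rdom x.
  by rewrite /H_op {2}/B SK// /B -[RHS]RE scalerDr opprD addrA.
have KB z : B (z - H z) = z.
  have [dS SE] := Sdom z.
  have -> : z - H z = S z - h *: (C (S z) + D t (S z)).
    by rewrite -{1}SE /H_op scalerDr opprD addrA.
  by rewrite /B /R_op RK.
exists B; split => //.
(* The formula for [B] contains the unbounded [C]; its bound comes instead from [B x = x + H (B x)],
   which gives [|B x| <= |x| + q |B x|]. *)
apply: (@linear_lipschitz_continuous _ _ B ((1 - q)^-1)) => // x.
rewrite mulrC ler_pdivlMr ?subr_gt0// mulrBr mulr1 lerBlDr.
rewrite -{1}[B x](subrK (H (B x))) BK mulrC.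
by apply: le_trans (ler_normD _ _) _; rewrite lerD2l H_op_le.
Qed.

Local Notation B := (bounded_inverse setT (fun z => z - H z)).

Lemma one_sub_H_op_inverse_le x : `|B x| <= (1 - q)^-1 * `|x|.
Proof.
have [_ _ BK _] := one_sub_H_op_inverse.
rewrite mulrC ler_pdivlMr ?subr_gt0// mulrBr mulr1 lerBlDr.
have [_ {2}<-] := BK x.
rewrite -{1}[B x](subrK (H (B x))) [_ * q]mulrC.
by apply: le_trans (ler_normD _ _) _; rewrite lerD2l H_op_le.
Qed.

(** As [(I - h C) S x = x], the vector [x - H x] is [(I - h (C + D)) S x]. The existence of [S]
    bounds it only for each [h] separately; this identity makes the bound uniform in [h]. *)
Lemma resolvent_R_op x : S x = RR (x - H x).
Proof.
have [_ _ Sdom _] := resolventP rC; have [_ _ _ RK] := resolventP rCD.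
have [dS SE] := Sdom x.
by rewrite -{2}SE /H_op /R_op -[in LHS](RK _ dS) scalerDr opprD addrA.
Qed.

Variable M : R.
Hypothesis RM : (op_norm (fun x => `|x|%:E) RR <= M%:E)%E.

Let lR : linear RR. Proof. by have [] := resolventP rCD. Qed.

Let M0 : 0 <= M. Proof. exact: op_norm_norm_ge0 RM. Qed.

Lemma resolvent_le x : `|S x| <= M * (1 + q) * `|x|.
Proof.
rewrite resolvent_R_op; apply: le_trans (linear_op_norm_le lR RM _) _.
rewrite -mulrA ler_wpM2l// mulrDl mul1r.
by apply: le_trans (ler_normB _ _) _; rewrite lerD2l H_op_le.
Qed.

Lemma R_op_sub_P_op_le x :
  `|RR x - P_op dom C D h t x| <= (M + (1 - q)^-1 * (M * (1 + q))) * `|x|.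
Proof.
apply: le_trans (ler_normB _ _) _; rewrite mulrDl lerD//.
  exact: linear_op_norm_le.
rewrite /P_op; apply: le_trans (one_sub_H_op_inverse_le _) _.
rewrite -[leRHS]mulrA ler_wpM2l ?invr_ge0 ?subr_ge0 ?(ltW q1)//.
exact: resolvent_le.
Qed.

Variables a b : R.
Hypotheses (a0 : 0 <= a) (b0 : 0 <= b).
Hypothesis Dab : forall z, dom z -> `|D t z| <= a * `|z| + b * `|C z|.

Let q0 : 0 <= q. Proof. exact: op_norm_norm_ge0 Hq. Qed.

(** From [z = RR (z - h (C + D) z)] one gets [RR z - z = h RR ((C + D) z)], and graph-boundedness
    controls [(C + D) z]. *)
Lemma R_op_sub_id_le z : dom z ->
  `|RR z - z| <= h * (M * (1 + a + b)) * graph_norm C z.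
Proof.
move=> dz; have [_ _ _ RK] := resolventP rCD.
have RB x y : RR (x - y) = RR x - RR y.
  by rewrite addrC -scaleN1r lR scaleN1r addrC.
rewrite -[z in X in _ - X](RK _ dz) -/(RR _) -RB opprB addrC subrK.
apply: le_trans (linear_op_norm_le lR RM _) _.
rewrite normrZ gtr0_norm// mulrCA -!mulrA ler_pM2l// ler_wpM2l//.
apply: le_trans (ler_normD _ _) _; apply: le_trans (lerD (lexx _) (Dab _ dz)) _.
have ? : 0 <= a * `|C z| by rewrite mulr_ge0.
have ? : 0 <= (1 + b) * `|z| by rewrite mulr_ge0// addr_ge0.
rewrite /graph_norm; lra.
Qed.

(** With [z = B (z - H z)], the difference is [B (S z - z + H z) = h B ((C + D) S z)]. Since
    [C S z = S C z], the bound on [S] controls the graph norm of [S z] by that of [z]. *)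
Lemma P_op_sub_id_le z : dom z ->
  `|P_op dom C D h t z - z| <=
    h * ((1 - q)^-1 * (M * (1 + q) * (1 + a + b))) * graph_norm C z.
Proof.
move=> dz; have [lB _ _ BK] := one_sub_H_op_inverse.
have [_ _ Sdom _] := resolventP rC.
have BB x y : B (x - y) = B x - B y.
  by rewrite addrC -scaleN1r lB scaleN1r addrC.
rewrite /P_op -[z in X in _ - X](BK _ Logic.I) -BB.
apply: le_trans (one_sub_H_op_inverse_le _) _.
rewrite (mulrCA h) -[leRHS]mulrA ler_wpM2l ?invr_ge0 ?subr_ge0 ?(ltW q1)//.
rewrite opprB addrCA -scale_generator_resolvent// /H_op -scalerDr addrC.
rewrite normrZ gtr0_norm// -[leRHS]mulrA ler_pM2l//.
have [dS _] := Sdom z.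
apply: le_trans (ler_normD _ _) _; apply: le_trans (lerD (lexx _) (Dab _ dS)) _.
rewrite -(resolvent_generatorC _ h0 rC)//.
have := resolvent_le z; have := resolvent_le (C z).
rewrite /graph_norm; set m := M * (1 + q) => uCz uz.
have m0 : 0 <= m by rewrite mulr_ge0// addr_ge0.
have ? : a * `|S z| <= a * (m * `|z|) by rewrite ler_wpM2l.
have ? : (1 + b) * `|S (C z)| <= (1 + b) * (m * `|C z|).
  by rewrite ler_wpM2l// addr_ge0.
have ? : 0 <= a * (m * `|C z|) by apply: mulr_ge0 => //; exact: mulr_ge0.
have ? : 0 <= (1 + b) * (m * `|z|).
  by apply: mulr_ge0; [exact: addr_ge0|exact: mulr_ge0].
lra.
Qed.

End resolvent_comparison.

(** * From the two endpoint bounds to the rate [h^theta] *)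

Lemma interp_op_norm_le {R : realType} {V : normedModType R} (dom : set V)
    (N : V -> R) (theta h K0 K1 : R) (A : V -> V) :
  (forall x, 0 <= N x) -> dom 0 -> 0 < theta -> 0 < h -> 0 <= K0 -> 0 <= K1 ->
  (forall x y, A (x + y) = A x + A y) ->
  (forall x, `|A x| <= K0 * `|x|) ->
  (forall x, dom x -> `|A x| <= h * K1 * N x) ->
  (op_norm (interp_norm dom N theta) A
    <= ((K0 + K1) * 2 * 2 `^ theta * h `^ theta)%:E)%E.
Proof.
move=> N0 d0 t0 h0 K00 K10 AD AK0 AK1; apply: op_norm_le => x Nx.
(* Taken at [s = h] on the unit ball of the interpolation space, this yields
   [K(h, x) <= 2 (2 h)^theta]. *)
have cK := interp_norm_ge dom N N0 d0 theta h x t0 h0.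
have : (2 * h) `^ (- theta) / 2 * K_functional dom N h x <= 1.
  by rewrite -lee_fin; exact: le_trans Nx.
have p0 : 0 < (2 * h) `^ theta by apply: powR_gt0; rewrite mulr_gt0.
rewrite powRN -mulrA ler_pdivrMl// mulr1 mulrC ler_pdivrMr// => Kle.
have K_ge0 : 0 <= K0 + K1 by exact: addr_ge0.
apply: (@le_trans _ _ ((K0 + K1) * K_functional dom N h x)); last first.
  rewrite -!mulrA ler_wpM2l// -powRM//; last exact: ltW.
  by rewrite [leRHS]mulrC.
(* Passing to the infimum divides by [K0 + K1]; if that vanishes, so does [K0], and [A] is zero. *)
have [K_eq0|K_neq0] := eqVneq (K0 + K1) 0.
  rewrite K_eq0 mul0r; apply: le_trans (AK0 x) _.
  by rewrite (_ : K0 = 0) ?mul0r//; lra.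
have K_gt0 : 0 < K0 + K1 by rewrite lt_neqAle eq_sym K_neq0.
rewrite mulrC -ler_pdivrMr//; apply: lb_le_inf.
  by exists (`|x| + h * N 0), x, 0; split => //; rewrite addr0.
move=> _ [y [z [dz -> ->]]]; rewrite ler_pdivrMr// AD.
apply: le_trans (ler_normD _ _) _; apply: le_trans (lerD (AK0 y) (AK1 _ dz)) _.
have ? : 0 <= K1 * `|y| by exact: mulr_ge0.
have ? : 0 <= K0 * (h * N z) by rewrite !mulr_ge0// ltW.
lra.
Qed.

Theorem proposition4p6 (R : realType) (X : completeNormedModType R)
  (tau T p : R) (tau_lt0 : tau < 0) (T_gt0 : 0 < T) (p_gt1 : 1 < p)
  (hC : forall h : R, 0 < h ->
    has_resolvent (transport_dom X tau p_gt1) (transport X tau p_gt1) h)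
  (D : R -> Ep X tau p_gt1 -> Ep X tau p_gt1)
  (hD : forall s : R, 0 <= s <= T ->
    linear_on (transport_dom X tau p_gt1) (D s))
  (theta : R) (theta01 : 0 < theta < 1)
  (h0 q : R) (h0_gt0 : 0 < h0) (q01 : 0 < q < 1)
  (hH : forall s : R, 0 <= s <= T -> forall h : R, 0 < h <= h0 ->
    (op_norm (fun x => `|x|%:E)
       (H_op (transport_dom X tau p_gt1) (transport X tau p_gt1) D h s)
     <= q%:E)%E)
  (t : R) (t0T : 0 <= t <= T) (MR : R)
  (hR : forall h : R, 0 < h <= h0 ->
    has_resolvent (transport_dom X tau p_gt1)
      (fun z => transport X tau p_gt1 z + D t z) h)
  (hMR : forall h : R, 0 < h <= h0 ->
    (op_norm (fun x => `|x|%:E)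
       (R_op (transport_dom X tau p_gt1) (transport X tau p_gt1) D h t)
     <= MR%:E)%E)
  (a b : R) (a_ge0 : 0 <= a) (b_ge0 : 0 <= b)
  (hab : forall s : R, 0 <= s <= T -> forall z, transport_dom X tau p_gt1 z ->
    `|D s z| <= a * `|z| + b * `|transport X tau p_gt1 z|) :
  exists K : R, 0 < K /\ forall h : R, 0 < h <= h0 ->
    (op_norm
       (interp_norm (transport_dom X tau p_gt1)
          (graph_norm (transport X tau p_gt1)) theta)
       (fun x => (
          R_op (transport_dom X tau p_gt1) (transport X tau p_gt1) D h t x -
          P_op (transport_dom X tau p_gt1) (transport X tau p_gt1) D h t x)%R)
     <= (K * h `^ theta)%:E)%E.
Proof.
have q_ge0 : 0 <= q by lra.
have Hq h : 0 < h <= h0 -> _ := hH t t0T h.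
have M_ge0 : 0 <= MR by apply: (op_norm_norm_ge0 (hMR h0 _)); rewrite h0_gt0 lexx.
have ? : 0 < (1 - q)^-1 by rewrite invr_gt0; lra.
(* The domain contains a value of the resolvent at step 1 and is closed under linear combinations,
   so weak derivatives and traces need not be examined. *)
have dom0 : transport_dom X tau p_gt1 0.
  have [_ _ Sdom _] := resolventP (hC 1 ltr01); have [d _] := Sdom 0.
  have := resolvent_dom_linear _ _ _ (hC 1 ltr01) (-1) _ _ d d.
  by rewrite scaleN1r addNr.
(* [K0] serves the norm of E_p and [K1], up to the factor [h], the graph norm; neither depends on
   [h]. *)
pose K0 := MR + (1 - q)^-1 * (MR * (1 + q)).
pose K1 := MR * (1 + a + b) + (1 - q)^-1 * (MR * (1 + q) * (1 + a + b)).
have K0_ge0 : 0 <= K0.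
  by rewrite addr_ge0// !mulr_ge0// ?addr_ge0// ltW.
have K1_ge0 : 0 <= K1.
  by rewrite addr_ge0// !mulr_ge0// ?addr_ge0// ltW.
have theta_gt0 : 0 < theta by case/andP: theta01.
(* The added 1 keeps the constant positive when [MR = 0], where [K0] and [K1] vanish. *)
exists ((K0 + K1 + 1) * 2 * 2 `^ theta); split.
  by rewrite !mulr_gt0 ?powR_gt0// ltr_wpDl// addr_ge0.
move=> h h0h; have /andP[h_gt0 _] := h0h.
have q1 : q < 1 by lra.
have lB := one_sub_H_op_inverse _ _ D h t q h_gt0 (hC h h_gt0) (hR h h0h)
  (hD t t0T) (Hq h h0h) q1.
apply: le_trans (_ : _ <= ((K0 + K1) * 2 * 2 `^ theta * h `^ theta)%:E)%E _.
  apply: interp_op_norm_le => //.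
  - by move=> x; rewrite addr_ge0.
  - move=> x y; have [lS _ _ _] := resolventP (hC h h_gt0).
    have [lR _ _ _] := resolventP (hR h h0h); have [lB' _ _ _] := lB.
    rewrite /R_op /P_op (linear_additive lS) (linear_additive lR).
    by rewrite (linear_additive lB') opprD addrACA.
  - move=> x; apply: R_op_sub_P_op_le => //.
    + exact: hC.
    + exact: hR.
    + exact: hD.
    + exact: Hq.
    + exact: hMR.
  - move=> z dz; rewrite -[R_op _ _ _ _ _ _](subrK z) -addrA.
    apply: le_trans (ler_normD _ _) _.
    rewrite [h * K1]mulrDr mulrDl [`|z - _|]distrC lerD//.
    + apply: R_op_sub_id_le => //; [exact: hR|exact: hMR|exact: hab].
    + apply: P_op_sub_id_le => //.
      * exact: hC.
      * exact: hR.
      * exact: hD.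
      * exact: Hq.
      * exact: hMR.
      * exact: hab.
rewrite lee_fin !ler_wpM2r ?powR_ge0//; lra.
Qed.
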